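(* Let $n$ be a positive integer, let $X_n=\{x_1,\dots,x_n\}$ be the discrete space with $n$ points, let $Y$ be a compact Hausdorff space, and let $Y_1\subseteq Y$ be a closed subset. Let $\sim$ be the equivalence relation on $X_n\times Y$ given by: $(x',y')\sim(x'',y'')$ if and only if either $y'=y''\in Y_1$, or $y'=y''$ and $x'=x''$. If $Y$ is connected and $Y_1$ is nonempty, then the quotient space $(X_n\times Y)/\sim$ is connected.
   Context: $X_n\times Y$ carries the product topology and $(X_n\times Y)/\sim$ the quotient topology. *)

(* Defs.v *)
From mathcomp Require Import all_boot generic_quotient all_classical.
From mathcomp Require Import topology.

Set Implicit Arguments.
Unset Strict Implicit.
Unset Printing Implicit Defensive.

Local Open Scope classical_set_scope.
Local Open Scope quotient_scope.

(* X_n: the points x_1, ..., x_n are the ordinals 0, ..., n - 1. *)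
Notation discrete_points n := (discrete_topology 'I_n).

Definition glue_prop (n : nat) (Y : topologicalType) (Y1 : set Y)
    (p q : discrete_points n * Y) : Prop :=
  (p.2 = q.2 /\ Y1 p.2) \/ (p.2 = q.2 /\ p.1 = q.1).

(* [{eq_quot _}] requires a boolean relation. *)
Definition glue_rel (n : nat) (Y : topologicalType) (Y1 : set Y) :
    rel (discrete_points n * Y) :=
  fun p q => `[< glue_prop Y1 p q >].

Lemma glue_rel_refl n (Y : topologicalType) (Y1 : set Y) :
  reflexive (@glue_rel n Y Y1).
Proof. by move=> p; apply/asboolP; right. Qed.

Lemma glue_rel_sym n (Y : topologicalType) (Y1 : set Y) :
  symmetric (@glue_rel n Y Y1).
Proof.
move=> p q; apply/asboolP/asboolP.
- by case=> -[e h]; [left; rewrite -e | right].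
- by case=> -[e h]; [left; rewrite -e | right].
Qed.

Lemma glue_rel_trans n (Y : topologicalType) (Y1 : set Y) :
  transitive (@glue_rel n Y Y1).
Proof.
move=> q p r /asboolP pq /asboolP qr; apply/asboolP.
case: pq => -[e1 h1]; case: qr => -[e2 h2].
- by left; split=> //; rewrite e1.
- by left; split=> //; rewrite e1.
- by left; split; rewrite e1.
- by right; split; [rewrite e1 | rewrite h1].
Qed.

Canonical glue_equiv n (Y : topologicalType) (Y1 : set Y) :=
  EquivRel (@glue_rel n Y Y1) (@glue_rel_refl n Y Y1)
    (@glue_rel_sym n Y Y1) (@glue_rel_trans n Y Y1).

Definition glue_space (n : nat) (Y : topologicalType) (Y1 : set Y) :
    topologicalType :=
  quotient_topology {eq_quot @glue_equiv n Y Y1}.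

(* Main.v *)
Require Import Defs.
From mathcomp Require Import all_boot all_classical topology.
From mathcomp Require Import generic_quotient.

Local Open Scope classical_set_scope.
Local Open Scope quotient_scope.

(** The quotient is the union of the images of the n copies [{i} * Y] of [Y].
    Each image is connected ([sheet_connected]), being a continuous image of
    the connected space [Y].  All of them contain the class of a point
    [(i, y)] with [y] in [Y1], which does not depend on [i] ([sheet_glued]).
    A union of connected sets with a common point is connected. *)

Definition sheet {n : nat} {Y : topologicalType} (Y1 : set Y)
    (i : discrete_points n) (y : Y) : glue_space n Y1 :=
  \pi_{eq_quot @glue_equiv n Y Y1} (i, y).

Lemma sheet_glued (n : nat) (Y : topologicalType) (Y1 : set Y)
    (i j : discrete_points n) (y : Y) :
  Y1 y -> sheet Y1 i y = sheet Y1 j y.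
Proof. by move=> Y1y; apply/eqmodP/asboolP; left. Qed.

Lemma sheet_continuous (n : nat) (Y : topologicalType) (Y1 : set Y)
    (i : discrete_points n) :
  continuous (sheet Y1 i).
Proof.
move=> y.
apply: (@continuous_comp _ _ _ (pair i) \pi_(glue_space n Y1)).
  exact: (cvg_pair (cvg_cst i) cvg_id).
exact: pi_continuous.
Qed.

Lemma sheet_connected (n : nat) (Y : topologicalType) (Y1 : set Y)
    (i : discrete_points n) :
  connected [set: Y] -> connected (range (sheet Y1 i)).
Proof.
move=> Yc; apply: connected_continuous_connected Yc _.
exact/continuous_subspaceT/sheet_continuous.
Qed.

Lemma bigcup_sheets (n : nat) (Y : topologicalType) (Y1 : set Y) :
  \bigcup_i range (sheet Y1 i) = [set: glue_space n Y1].
Proof.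
apply/seteqP; split=> // z _; exists (repr z).1 => //.
exists (repr z).2 => //; rewrite /sheet -surjective_pairing.
exact: reprK.
Qed.

Theorem proposition3p7 (n : nat) (n_gt0 : (0 < n)%N)
    (Y : topologicalType) (Y_compact : compact [set: Y])
    (Y_hausdorff : hausdorff_space Y)
    (Y1 : set Y) (Y1_closed : closed Y1)
    (Y_connected : connected [set: Y]) (Y1_nonempty : Y1 !=set0) :
  connected [set: glue_space n Y1].
Proof.
have [y Y1y] := Y1_nonempty.
rewrite -bigcup_sheets; apply: bigcup_connected.
- (* The index 0 only names the common class of the points (i, y). *)
  exists (sheet Y1 (Ordinal n_gt0) y) => i _.
  by exists y => //; exact: sheet_glued.
- by move=> i _; exact: sheet_connected.
Qed.
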